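(* Let $(M,h)$ be a Riemannian spin surface with local isothermal coordinates $x,y$, let $\psi=(\psi^1,\dots,\psi^q)$ with $\psi^1,\dots,\psi^q\in\Gamma(\Sigma M)$, and let $i,m\in\{1,\dots,q\}$. If, with summation over $j=1,\dots,q$, $$|P_-\psi^j|_{\Sigma M}^2\langle P_-\psi^i,P_-\psi^m\rangle_{\Sigma M}=|P_+\psi^j|_{\Sigma M}^2\langle P_+\psi^i,P_+\psi^m\rangle_{\Sigma M},$$ then, again with summation over $j$, $$\langle\psi^i,\partial_x\cdot\psi^j\rangle_{\Sigma M}\langle\psi^j,\partial_y\cdot\psi^m\rangle_{\Sigma M} -\langle\psi^i,\partial_y\cdot\psi^j\rangle_{\Sigma M}\langle\psi^j,\partial_x\cdot\psi^m\rangle_{\Sigma M} =2\langle\psi^i,\partial_x\cdot\partial_y\cdot\psi^m\rangle_{\Sigma M}|\psi|^2.$$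
   Context: $\Sigma M$ is the (complex rank 2) spinor bundle of $(M,h)$ with hermitian scalar product $\langle\cdot,\cdot\rangle_{\Sigma M}$. Clifford multiplication by tangent vectors is skew-symmetric, $\langle\psi,X\cdot\eta\rangle=-\langle X\cdot\psi,\eta\rangle$, and satisfies $X\cdot Y\cdot\psi+Y\cdot X\cdot\psi=-2h(X,Y)\psi$. For an oriented local orthonormal frame $e_1,e_2$ the complex volume element is $\omega_{\mathbb{C}}=i\,e_1\cdot e_2$, and $P_\pm=\frac12(1\pm\omega_{\mathbb{C}})$ are the projectors onto the bundles of positive and negative spinors. $|\psi|^2=\sum_{j=1}^q|\psi^j|^2_{\Sigma M}$. *)

(* Defs.v *)
From HB Require Import structures.
From mathcomp Require Import all_boot all_order all_algebra.
From mathcomp Require Import sesquilinear spectral.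
From mathcomp Require Import complex.
From mathcomp Require Import all_classical all_reals all_analysis.

Set Implicit Arguments.
Unset Strict Implicit.
Unset Printing Implicit Defensive.

Import Order.TTheory GRing.Theory Num.Theory.
Import numFieldNormedType.Exports.

Local Open Scope classical_set_scope.
Local Open Scope ring_scope.

(* C^k, resp. C^oo, on an open set A of a finite-dimensional space V. *)
Fixpoint Ck (R : realType) (V W : normedModType R) (k : nat) (A : set V)
    (f : V -> W) : Prop :=
  (forall x, A x -> {for x, continuous f}) /\
  match k with
  | 0 => True
  | k'.+1 => forall v, (forall x, A x -> derivable f x v) /\ Ck k' A ('D_v f)
  end.

Definition smooth (R : realType) (V W : normedModType R) (A : set V)
    (f : V -> W) : Prop := forall k, Ck k A f.

Section Charts.
Variables (R : realType) (M : topologicalType).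

Record chart := Chart {
  dom : set M;
  coord : M -> 'rV[R]_2;
  cinv : 'rV[R]_2 -> M;
  dom_open : open dom;
  img_open : open (coord @` dom);
  coordK : forall p, dom p -> cinv (coord p) = p;
  coord_cts : forall p, dom p -> {for p, continuous coord};
  cinv_cts : forall u, (coord @` dom) u -> {for u, continuous cinv}
}.

(* f is smooth on A, a subset of the domain of c, read in the chart c *)
Definition smooth_in (W : normedModType R) (c : chart) (A : set M)
    (f : M -> W) : Prop := smooth (coord c @` A) (f \o cinv c).

Definition smooth_compatible (c d : chart) : Prop :=
  smooth_in c (dom c `&` dom d) (coord d) /\
  smooth_in d (dom c `&` dom d) (coord c).

(* Tangent vectors are row vectors of components: X in the chart c becomes
   X *m change c d p in the chart d. *)
Definition change (c d : chart) (p : M) : 'M[R]_2 :=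
  'J (coord d \o cinv c) (coord c p).

(* A smooth oriented surface.  As in the preferred-chart presentation of the
   tangent bundle, [chart_at] selects for each point a chart around it, and the
   tangent space at p is 'rV[R]_2, through the chart [chart_at p]. *)
Record surface := Surface {
  idx : Type;
  atlas : idx -> chart;
  chart_at : M -> idx;
  chart_atP : forall p, dom (atlas (chart_at p)) p;
  atlas_compatible : forall c d, smooth_compatible (atlas c) (atlas d);
  atlas_oriented : forall c d p, dom (atlas c) p -> dom (atlas d) p ->
    0 < \det (change (atlas c) (atlas d) p);
  surface_hausdorff : hausdorff_space M;
  surface_second_countable : @second_countable M
}.

(* [gram c p] is the matrix of the metric in the coordinates of the chart c. *)
Record riemannian_metric (S : surface) := Metric {
  gram : idx S -> M -> 'M[R]_2;
  gram_sym : forall c p, dom (atlas c) p -> (gram c p)^T = gram c p;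
  gram_pos : forall c p (X : 'rV[R]_2), dom (atlas c) p -> X != 0 ->
    0 < (X *m gram c p *m X^T) 0 0;
  gram_change : forall c d p, dom (atlas c) p -> dom (atlas d) p ->
    gram c p = change (atlas c) (atlas d) p *m gram d p
                 *m (change (atlas c) (atlas d) p)^T;
  gram_smooth : forall c, smooth_in (atlas c) (dom (atlas c)) (gram c)
}.

(* X and Y are given by their components in the chart c. *)
Definition inner (S : surface) (h : riemannian_metric S) (c : idx S) (p : M)
    (X Y : 'rV[R]_2) : R := (X *m gram h c p *m Y^T) 0 0.

(* The rotation by the argument of the unit complex number z, acting on rows:
   if a *m rotation z = b then b_0 + i b_1 = z (a_0 + i a_1). *)
Definition rotation (z : R[i]) : 'M[R]_2 :=
  \matrix_(k < 2, l < 2)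
    if k == 0 then (if l == 0 then complex.Re z else complex.Im z)
    else (if l == 0 then - complex.Im z else complex.Re z).

(* A spin structure, as a Cech cocycle.  The rows of [frame c p] are the
   components, in the chart c, of an oriented orthonormal frame e_1, e_2.
   The frames of two charts differ by a function with values in SO(2); [spin_lift]
   lifts it through the double covering z |-> z^2 from Spin(2) = U(1) to
   SO(2) = U(1), the lifts being required to form a cocycle.
   Every spin structure is of this form for an atlas of contractible charts. *)
Record spin_structure (S : surface) (h : riemannian_metric S) := SpinStructure {
  frame : idx S -> M -> 'M[R]_2;
  frame_smooth : forall c, smooth_in (atlas c) (dom (atlas c)) (frame c);
  frame_orthonormal : forall c p, dom (atlas c) p ->
    frame c p *m gram h c p *m (frame c p)^T = 1%:M;
  frame_oriented : forall c p, dom (atlas c) p -> 0 < \det (frame c p);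
  spin_lift : idx S -> idx S -> M -> R[i];
  spin_lift_unit : forall c d p, dom (atlas c) p -> dom (atlas d) p ->
    `|spin_lift c d p| = 1;
  spin_lift_frame : forall c d p, dom (atlas c) p -> dom (atlas d) p ->
    frame c p *m change (atlas c) (atlas d) p
      = rotation (spin_lift c d p ^+ 2) *m frame d p;
  spin_lift_cocycle : forall c d e p,
    dom (atlas c) p -> dom (atlas d) p -> dom (atlas e) p ->
    spin_lift c e p = spin_lift c d p * spin_lift d e p;
  spin_lift_smooth : forall c d,
    smooth_in (atlas c) (dom (atlas c) `&` dom (atlas d))
      (fun p => complex.Re (spin_lift c d p) : R^o) /\
    smooth_in (atlas c) (dom (atlas c) `&` dom (atlas d))
      (fun p => complex.Im (spin_lift c d p) : R^o)
}.

End Charts.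

Record spin_surface (R : realType) (M : topologicalType) := SpinSurface {
  carrier_surface :> surface R M;
  surface_metric : riemannian_metric carrier_surface;
  surface_spin : spin_structure surface_metric
}.

Section Spinors.
Variable R : realType.
Local Notation C := R[i].
Local Notation spinor := 'cV[C]_2.

(* Clifford multiplication by a_1 e_1 + a_2 e_2 on C^2, where z = a_1 + i a_2:
   the matrix ((0, - z^* ), (z, 0)), so that e_1 e_2 acts as diag(-i, i). *)
Definition gamma (a1 a2 : R) : 'M[C]_2 :=
  \matrix_(k < 2, l < 2)
    if k == l then 0
    else if k == 0 then - Complex a1 (- a2) else Complex a1 a2.

(* The complex spinor representation of Spin(2) = U(1): the element
   s = cos t + i sin t, that is cos t + sin t e_1 e_2, acts as diag(s^*, s). *)
Definition spin_rep (s : C) : 'M[C]_2 :=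
  \matrix_(k < 2, l < 2) if k != l then 0 else if k == 0 then conjc s else s.

Variables (M : topologicalType) (S : spin_surface R M).
Local Notation h := (surface_metric S).
Local Notation sigma := (surface_spin S).

Definition e1 (c : idx S) (p : M) : 'rV[R]_2 := row 0 (frame sigma c p).
Definition e2 (c : idx S) (p : M) : 'rV[R]_2 := row 1 (frame sigma c p).

(* Spinors in the trivialisation over the chart c; X in components in c *)
Definition clifford_in (c : idx S) (p : M) (X : 'rV[R]_2) (v : spinor) :
    spinor :=
  gamma (inner h c p X (e1 c p)) (inner h c p X (e2 c p)) *m v.

Definition spinor_to (c : idx S) (p : M) (v : spinor) : spinor :=
  spin_rep (spin_lift sigma (chart_at S p) c p) *m v.

(* The fibre of the spinor bundle at p is C^2, through the trivialisation over
   the chart [chart_at S p]; a section is thus a function M -> C^2 whose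
   representatives in all trivialisations are smooth. *)
Definition spinor_section (psi : M -> spinor) : Prop :=
  forall (c : idx S) (k : 'I_2),
    smooth_in (atlas c) (dom (atlas c))
      (fun p => complex.Re (spinor_to c p (psi p) k 0) : R^o) /\
    smooth_in (atlas c) (dom (atlas c))
      (fun p => complex.Im (spinor_to c p (psi p) k 0) : R^o).

Definition clifford (p : M) : 'rV[R]_2 -> spinor -> spinor :=
  clifford_in (chart_at S p) p.

(* the hermitian product, linear in its first argument *)
Definition herm (v w : spinor) : C := dotmx v^T w^T.
Definition sqnorm (v : spinor) : C := herm v v.

Definition complex_volume (p : M) (v : spinor) : spinor :=
  (Complex 0 1 : C) *: clifford p (e1 (chart_at S p) p) (clifford p (e2 (chart_at S p) p) v).

Definition Pplus (p : M) (v : spinor) : spinor := 2^-1 *: (v + complex_volume p v).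
Definition Pminus (p : M) (v : spinor) : spinor := 2^-1 *: (v - complex_volume p v).

(* d/dx for k = 0 and d/dy for k = 1, where z = (x, y) *)
Definition coord_field (z : chart R M) (k : 'I_2) (p : M) : 'rV[R]_2 :=
  row k (change z (atlas (chart_at S p)) p).

Definition metric_at (p : M) : 'rV[R]_2 -> 'rV[R]_2 -> R :=
  inner h (chart_at S p) p.

(* Coordinates x, y with h = lambda (dx^2 + dy^2), lambda > 0.  They belong to
   the smooth structure but need not be compatible with the orientation. *)
Definition isothermal (z : chart R M) : Prop :=
  (forall c : idx S, smooth_compatible z (atlas c)) /\
  exists lambda : M -> R, forall p, dom z p ->
    0 < lambda p /\
    forall k l : 'I_2,
      metric_at p (coord_field z k p) (coord_field z l p) = lambda p *+ (k == l).

End Spinors.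

(* Main.v *)
(* In the trivialisation by the frame e_1, e_2, a spinor is a pair (u, v) with
   components P_+ = u and P_- = v, and the vectors d/dx and d/dy act through
   complex numbers a and b. The left-hand side is
   - (a b^* - a^* b) (u_i u_m^* V - v_i v_m^* U) with U = sum |u_j|^2 and
   V = sum |v_j|^2; orthogonality of d/dx and d/dy makes a b^* imaginary, so the
   right-hand side is - (a b^* - a^* b) (u_i u_m^* - v_i v_m^* ) (U + V), and
   the two differ by a multiple of v_i v_m^* V - u_i u_m^* U, which the hypothesis
   annihilates. *)
Require Import Defs.
From mathcomp Require Import all_boot all_order all_algebra.
From mathcomp Require Import spectral ring.
From mathcomp Require Import complex.
From mathcomp Require Import all_classical all_reals all_analysis.

Set Implicit Arguments.
Unset Strict Implicit.
Unset Printing Implicit Defensive.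

Import Order.TTheory GRing.Theory Num.Theory.
Import numFieldNormedType.Exports.

Local Open Scope ring_scope.

Lemma sum_ord2 (V : nmodType) (F : 'I_2 -> V) : \sum_i F i = F 0 + F 1.
Proof.
by rewrite big_ord_recr big_ord1 /=; congr (F _ + F _); apply: val_inj.
Qed.

Lemma hermE (R : realType) (v w : 'cV[R[i]]_2) :
  herm v w = v 0 0 * (w 0 0)^* + v 1 0 * (w 1 0)^*.
Proof. by rewrite /herm dotmxE mxE sum_ord2 !mxE. Qed.

Section PointwiseAlgebra.
Variable C : numClosedFieldType.

Lemma spinor_contraction (q : nat) (u v : 'I_q -> C) (i m : 'I_q) (a b : C) :
  a * b^* + a^* * b = 0 ->
  \sum_(j < q) v j * (v j)^* * (v i * (v m)^*)
    = \sum_(j < q) u j * (u j)^* * (u i * (u m)^*) ->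
  \sum_(j < q) (u i * (- a^* * v j)^* + v i * (a * u j)^*)
      * (u j * (- b^* * v m)^* + v j * (b * u m)^*)
  - \sum_(j < q) (u i * (- b^* * v j)^* + v i * (b * u j)^*)
      * (u j * (- a^* * v m)^* + v j * (a * u m)^*)
  = 2 * (u i * (- a^* * (b * u m))^* + v i * (a * (- b^* * v m))^*)
      * \sum_(j < q) (u j * (u j)^* + v j * (v j)^*).
Proof.
move=> ab; rewrite -!mulr_suml => UV.
have {}ab : a^* * b = - (a * b^*) by rewrite -[RHS]addr0 -ab addKr.
rewrite big_split /=; set U := \sum_j u j * _; set V := \sum_j v j * _.
rewrite -/U -/V in UV.
have -> : \sum_(j < q) (u i * (- a^* * v j)^* + v i * (a * u j)^*)
      * (u j * (- b^* * v m)^* + v j * (b * u m)^*)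
  - \sum_(j < q) (u i * (- b^* * v j)^* + v i * (b * u j)^*)
      * (u j * (- a^* * v m)^* + v j * (a * u m)^*)
  = (a^* * b - a * b^*) * (u i * (u m)^* * V - v i * (v m)^* * U).
  rewrite -sumrB !mulrBr !mulr_sumr -sumrB; apply: eq_bigr => j _.
  by rewrite !rmorphM !rmorphN /= !conjCK; ring.
rewrite !rmorphM !rmorphN /= !conjCK ab.
transitivity (- (2 * (a * b^*)) * ((u i * (u m)^* - v i * (v m)^*) * (U + V)
  + (V * (v i * (v m)^*) - U * (u i * (u m)^*)))); first by ring.
rewrite UV.
transitivity (2 * (- (a * b^*) * (u i * (u m)^*)
  - a^* * b * (v i * (v m)^*)) * (U + V)); first by rewrite ab; ring.
by ring.
Qed.

End PointwiseAlgebra.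

Section Trivialisation.
Variables (R : realType) (M : topologicalType) (S : spin_surface R M) (p : M).
Local Notation h := (surface_metric S).
Local Notation sigma := (surface_spin S).
Local Notation c := (chart_at S p).

Definition symbol (X : 'rV[R]_2) : R[i] :=
  Complex (inner h c p X (e1 c p)) (inner h c p X (e2 c p)).

Lemma clifford0 X v : clifford S p X v 0 0 = - (symbol X)^* * v 1 0.
Proof. by rewrite mxE sum_ord2 !mxE /= mul0r add0r. Qed.

Lemma clifford1 X v : clifford S p X v 1 0 = symbol X * v 0 0.
Proof. by rewrite mxE sum_ord2 !mxE /= mul0r addr0. Qed.

Lemma herm_clifford v X w :
  herm v (clifford S p X w) =
    v 0 0 * (- (symbol X)^* * w 1 0)^* + v 1 0 * (symbol X * w 0 0)^*.
Proof. by rewrite hermE clifford0 clifford1. Qed.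

Lemma herm_clifford2 v X Y w :
  herm v (clifford S p X (clifford S p Y w)) =
    v 0 0 * (- (symbol X)^* * (symbol Y * w 0 0))^*
    + v 1 0 * (symbol X * (- (symbol Y)^* * w 1 0))^*.
Proof. by rewrite herm_clifford clifford0 clifford1. Qed.

Lemma inner_frame_row (X : 'rV[R]_2) (k : 'I_2) :
  inner h c p X (row k (frame sigma c p))
    = (X *m gram h c p *m (frame sigma c p)^T) 0 k.
Proof. by rewrite /inner tr_row colE mulmxA -colE mxE. Qed.

Lemma inner_frame (k l : 'I_2) :
  inner h c p (row k (frame sigma c p)) (row l (frame sigma c p))
    = (k == l)%:R.
Proof.
rewrite inner_frame_row -!row_mul frame_orthonormal; last exact: chart_atP.
by rewrite !mxE.
Qed.

Lemma symbol_e1 : symbol (e1 c p) = 1.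
Proof. by rewrite /symbol !inner_frame. Qed.

Lemma symbol_e2 : symbol (e2 c p) = Complex 0 1.
Proof. by rewrite /symbol !inner_frame. Qed.

Lemma complex_volume0 v : complex_volume S p v 0 0 = v 0 0.
Proof.
rewrite mxE clifford0 clifford1 symbol_e1 symbol_e2 rmorph1.
by rewrite mulN1r mulrN mulrA -expr2 sqr_i mulN1r opprK.
Qed.

Lemma complex_volume1 v : complex_volume S p v 1 0 = - v 1 0.
Proof.
rewrite mxE clifford1 clifford0 symbol_e1 symbol_e2 mul1r mulrA mulrN.
suff -> : Complex 0 1 * (Complex 0 1 : R[i])^* = 1 by rewrite mulN1r.
by apply/eqP; rewrite eq_complex /= !mul0r !mul1r sub0r opprK addr0 !eqxx.
Qed.

Lemma Pplus0 v : Pplus S p v 0 0 = v 0 0.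
Proof.
rewrite mxE [X in _ * X]mxE complex_volume0 -mulr2n -[X in _ * X]mulr_natl.
by rewrite mulKf // pnatr_eq0.
Qed.

Lemma Pplus1 v : Pplus S p v 1 0 = 0.
Proof. by rewrite mxE [X in _ * X]mxE complex_volume1 subrr mulr0. Qed.

Lemma Pminus0 v : Pminus S p v 0 0 = 0.
Proof.
by rewrite mxE [X in _ * X]mxE [X in _ + X]mxE complex_volume0 subrr mulr0.
Qed.

Lemma Pminus1 v : Pminus S p v 1 0 = v 1 0.
Proof.
rewrite mxE [X in _ * X]mxE [X in _ + X]mxE complex_volume1 opprK.
by rewrite -mulr2n -[X in _ * X]mulr_natl mulKf // pnatr_eq0.
Qed.

Lemma herm_Pplus v w :
  herm (Pplus S p v) (Pplus S p w) = v 0 0 * (w 0 0)^*.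
Proof.
move: (Pplus0 v) (Pplus1 v) (Pplus0 w) (Pplus1 w).
move: (Pplus S p v) (Pplus S p w) => v' w' v0 v1 w0 w1.
by rewrite hermE v0 v1 w0 w1 mul0r addr0.
Qed.

Lemma herm_Pminus v w :
  herm (Pminus S p v) (Pminus S p w) = v 1 0 * (w 1 0)^*.
Proof.
move: (Pminus0 v) (Pminus1 v) (Pminus0 w) (Pminus1 w).
move: (Pminus S p v) (Pminus S p w) => v' w' v0 v1 w0 w1.
by rewrite hermE v0 v1 w0 w1 mul0r add0r.
Qed.

Lemma metric_atE X Y :
  metric_at S p X Y =
    complex.Re (symbol X) * complex.Re (symbol Y)
    + complex.Im (symbol X) * complex.Im (symbol Y).
Proof.
pose F := frame sigma c p; pose G := gram h c p.
have hp := chart_atP S p.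
have FGF : (G *m F^T) *m F = 1%:M.
  by apply: mulmx1C; rewrite mulmxA; exact: frame_orthonormal.
have -> : metric_at S p X Y = ((X *m G *m F^T) *m (Y *m G *m F^T)^T) 0 0.
  rewrite !trmx_mul trmxK (gram_sym h hp) -/G.
  by rewrite !mulmxA -(mulmxA X) -(mulmxA X) FGF mulmx1.
by rewrite mxE sum_ord2 ![_^T _ _]mxE -!inner_frame_row.
Qed.

Lemma symbol_orthogonal X Y : metric_at S p X Y = 0 ->
  symbol X * (symbol Y)^* + (symbol X)^* * symbol Y = 0.
Proof.
rewrite metric_atE; case: (symbol X) (symbol Y) => [a1 a2] [b1 b2] /= ab0.
apply/eqP; rewrite eq_complex /=; apply/andP; split; apply/eqP; last by ring.
by rewrite -[RHS](mulr0 2) -ab0; ring.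
Qed.

End Trivialisation.

Theorem corollary3p19 (R : realType) (M : topologicalType)
    (S : spin_surface R M) (z : chart R M) (hz : isothermal S z)
    (q : nat) (psi : 'I_q -> M -> 'cV[R[i]]_2)
    (hpsi : forall j, spinor_section S (psi j)) (i m : 'I_q)
    (hP : forall p : M,
      \sum_(j < q)
        sqnorm (Pminus S p (psi j p))
          * herm (Pminus S p (psi i p)) (Pminus S p (psi m p))
      = \sum_(j < q)
        sqnorm (Pplus S p (psi j p))
          * herm (Pplus S p (psi i p)) (Pplus S p (psi m p)))
    (p : M) (hp : dom z p) :
  let dx := coord_field S z 0 p in
  let dy := coord_field S z 1 p in
  \sum_(j < q)
     herm (psi i p) (clifford S p dx (psi j p))
       * herm (psi j p) (clifford S p dy (psi m p))
  - \sum_(j < q)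
     herm (psi i p) (clifford S p dy (psi j p))
       * herm (psi j p) (clifford S p dx (psi m p))
  = 2 * herm (psi i p) (clifford S p dx (clifford S p dy (psi m p)))
      * \sum_(j < q) sqnorm (psi j p).
Proof.
move=> dx dy.
have ab : symbol S p dx * (symbol S p dy)^*
    + (symbol S p dx)^* * symbol S p dy = 0.
  have [_ [lambda /(_ _ hp)[_ iso]]] := hz.
  by apply: symbol_orthogonal; exact: iso.
have Nsum j : sqnorm (Pminus S p (psi j p))
    * herm (Pminus S p (psi i p)) (Pminus S p (psi m p)) =
    psi j p 1 0 * (psi j p 1 0)^* * (psi i p 1 0 * (psi m p 1 0)^*).
  exact: (congr2 *%R (herm_Pminus _ _ _ _) (herm_Pminus _ _ _ _)).
have Psum j : sqnorm (Pplus S p (psi j p))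
    * herm (Pplus S p (psi i p)) (Pplus S p (psi m p)) =
    psi j p 0 0 * (psi j p 0 0)^* * (psi i p 0 0 * (psi m p 0 0)^*).
  exact: (congr2 *%R (herm_Pplus _ _ _ _) (herm_Pplus _ _ _ _)).
have := etrans (esym (eq_bigr _ (fun j _ => Nsum j)))
  (etrans (hP p) (eq_bigr _ (fun j _ => Psum j))).
move=> /(spinor_contraction ab (u := fun j => psi j p 0 0)
                               (v := fun j => psi j p 1 0)) contraction.
refine (etrans _ (etrans contraction _)).
  by congr (_ - _); apply: eq_bigr => j _;
    exact: (congr2 *%R (herm_clifford _ _ _ _ _) (herm_clifford _ _ _ _ _)).
apply: esym; rewrite herm_clifford2; congr (_ * _).
by apply: eq_bigr => j _; exact: hermE.
Qed.
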